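(* Let $s\ge 1$ be an integer. For $n\geq s-1$, the total number $g_n$ of occurrences of $1\times s$ rectangles over all Catalan words of length $n$ is $$g_n=\frac{1}{2}\left(\sum_{i=0}^{s-2}\frac{s-1-i}{i+1}\binom{2i}{i}\binom{2n-2i}{n-i}-(2s-1)\binom{2n}{n}+4^n\right).$$
   Context: For a word $w=w_1\cdots w_n$ of positive integers, its bargraph consists of $n$ consecutive columns of unit cells, aligned at the bottom, the $i$-th column having height $w_i$. An occurrence of a $1\times s$ rectangle in $w$ is a placement of a rectangle of height $1$ and width $s$ (with sides along the unit grid) inside the bargraph. Equivalently, the number of occurrences is $\sum_{i=1}^{n-s+1}\min\{w_i,\ldots,w_{i+s-1}\}$ (which is $0$ if $n<s$). The total number over a set of words is the sum of these numbers over all words in the set. A Catalan word of length $n$ is a word $w_1\cdots w_n$ of positive integers with $w_1=1$ and $w_{i+1}\le w_i+1$ for all $1\le i\le n-1$ (for $n=0$, only the empty word). Empty sums are $0$. *)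

(* Defs.v *)
From mathcomp Require Import all_boot.
Set Implicit Arguments.
Unset Strict Implicit.
Unset Printing Implicit Defensive.

(* Words are sequences of natural numbers; the letter w_i is nth 0 w (i - 1). *)

(* The default value 1 of head makes the empty word a Catalan word. *)
Definition catalan_word (w : seq nat) : bool :=
  [&& all (fun x => 0 < x) w, head 1 w == 1
    & sorted (fun x y => y <= x.+1) w].

(* A placement of the rectangle is recorded by the position of its bottom left
   corner: p.1 columns lie to its left and p.2 rows below it. It fits inside the
   bargraph iff it does not pass the right end and every column it meets has
   height at least p.2 + 1. For s >= 1 the bounds in the type of p exclude
   no placement. *)
Definition rect_occ (s : nat) (w : seq nat) : nat :=
  #|[set p : 'I_(size w) * 'I_(\max_(x <- w) x) |
      (p.1 + s <= size w) && [forall j : 'I_s, p.2 < nth 0 w (p.1 + j)]]|.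

(* The letters of a Catalan word of length n are at most n (see
   catalan_word_tuple), so tuples over 'I_n.+1 account for all such words. *)
Definition total_rect_occ (s n : nat) : nat :=
  \sum_(w : n.-tuple 'I_n.+1 | catalan_word (map val w))
     rect_occ s (map val w).

Lemma catalan_word_bound (w : seq nat) :
  catalan_word w -> all (fun x => x <= size w) w.
Proof.
case: w => [//|x w] /and3P[_ /= /eqP-> srt].
have H : forall v a, path (fun x y => y <= x.+1) a v ->
  all (fun z => z <= a + size v) v.
  elim=> [//|b v IHv] a /= /andP[ba /IHv Hv].
  rewrite (leq_trans ba) ?addnS ?ltnS ?leq_addr //=.
  apply: sub_all Hv => z /leq_trans -> //.
  by rewrite -addSn leq_add2r.
by have:= H w 1 srt; rewrite add1n.
Qed.

Lemma catalan_word_tuple (w : seq nat) :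
  catalan_word w ->
  exists t : (size w).-tuple 'I_(size w).+1, map val t = w.
Proof.
move=> /catalan_word_bound/allP Hw.
have sz : size (map (@inord (size w)) w) == size w by rewrite size_map.
exists (Tuple sz) => /=; rewrite -map_comp -[RHS]map_id.
by apply/eq_in_map => x /Hw xw /=; rewrite inordK.
Qed.

Lemma rect_occE (s : nat) (w : seq nat) : 0 < s ->
  rect_occ s w =
  \sum_(i < (size w).+1 - s) foldr minn (nth 0 w i) (take s (drop i w)).
Proof.
move=> s0.
have Hm : forall a h v, (h < foldr minn a v) = (h < a) && all (ltn h) v.
  move=> a h; elim=> [|b v IHv] /=; first by rewrite andbT.
  by rewrite leq_min IHv andbCA.
have nthmax i : nth 0 w i <= \max_(x <- w) x.
  have [lt|ge] := ltnP i (size w); last by rewrite nth_default.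
  by apply: leq_bigmax_seq => //; apply: mem_nth.
have fit i h : i + s <= size w ->
  [forall j : 'I_s, h < nth 0 w (i + j)] =
  (h < foldr minn (nth 0 w i) (take s (drop i w))).
  move=> le; rewrite Hm; apply/forallP/andP => [H|[_ /allP H] j].
    split; first by move: (H (Ordinal s0)); rewrite addn0.
    apply/(all_nthP 0) => j; rewrite size_take_min size_drop leq_min.
    case/andP=> js _; rewrite nth_take // nth_drop.
    exact: (H (Ordinal js)).
  rewrite -nth_drop -(nth_take 0 (ltn_ord j)).
  apply: H; apply: mem_nth; rewrite size_take_min size_drop leq_min ltn_ord /=.
  by rewrite ltn_subRL (leq_trans _ le) // ltn_add2l.
rewrite /rect_occ -sum1_card.
transitivity (\sum_(i < size w | i + s <= size w)
  foldr minn (nth 0 w i) (take s (drop i w))); last first.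
  have le : (size w).+1 - s <= size w.
    by rewrite leq_subLR -add1n leq_add2r.
  rewrite (big_ord_widen_cond _ xpredT
    (fun i => foldr minn (nth 0 w i) (take s (drop i w))) le).
  by apply: eq_bigl => i /=; rewrite ltn_subRL addnC ltnS.
transitivity (\sum_(i < size w | i + s <= size w)
  \sum_(h < \max_(x <- w) x | h < foldr minn (nth 0 w i) (take s (drop i w))) 1).
  rewrite pair_big_dep /=; apply: eq_bigl => -[i h]; rewrite inE /=.
  by case: (boolP (i + s <= size w)) => //= le; apply: fit.
apply: eq_bigr => i _.
have le : foldr minn (nth 0 w i) (take s (drop i w)) <= \max_(x <- w) x.
  apply: leq_trans (nthmax i).
  by elim: (take _ _) => //= a v IH; rewrite (leq_trans (geq_minr _ _)).
by rewrite -(big_ord_widen _ (fun=> 1) le) sum1_card card_ord.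
Qed.

(* Main.v *)
Require Import Defs.
From mathcomp Require Import all_boot all_order all_algebra.
From mathcomp Require Import zify ring lra.
Import Order.TTheory GRing.Theory Num.Theory.
Set Implicit Arguments.
Unset Strict Implicit.
Local Open Scope ring_scope.

(** Cutting a nonempty Catalan word before its second letter 1 writes it
    uniquely as [1 (u + 1) v], where [u] and [v] are Catalan words and [u + 1]
    is [u] with every letter raised by one ([big_catalan_wordsS]).  This is the
    arch decomposition of Dyck paths.

    Let [G w] be the number of occurrences of the rectangle of width [s] in
    [w].  In the bottom row every placement fits, which gives
    [phi |w| = max(|w| + 1 - s, 0)] occurrences.  In [w = 1 (u + 1) v], an
    occurrence above the bottom row either lies over [u + 1] and is one of [u],
    or lies over [v], so that
      [G w = G u + G v + phi |w| - phi |v|]      ([window_sum_glue]).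
    Let [c_n] be the Catalan numbers and [*] the convolution of sequences.
    Summing over all words of length [n + 1] turns this into
      [g_(n+1) = 2 (c * g)_n + phi_(n+1) c_(n+1) - ((phi c) * c)_n].

    The recurrence is linear in [phi], and its solution is [(phi c) * d] where
    [d_m] is half of the central binomial coefficient [b_m], except [d_0 = 1]
    ([catalan_recurrence_solution]).  Combinatorially, for [k >= 1], [c_k d_(n-k)] counts the
    maximal runs of exactly [k] columns reaching a common row, over all rows
    and all words of length [n], and such a run has [phi k] placements.

    For [n >= s - 1] the truncated weight [phi k] is [k + 1 - s] up to the terms
    with [k < s - 1], which make up the finite sum of the formula.  The rest is
    evaluated by [(k + 1) c_k = b_k] and the convolutions [b * b = 4^n] and
    [(c * b)_n = 2 b_n - c_n].

    In the code the width is [s.+1], so that [phi k] is the truncated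
    difference [k - s]. *)

(** * Convolution of sequences *)

Section Convolution.
Variable R : comNzRingType.
Implicit Types f g h : nat -> R.

Definition conv f g n : R := \sum_(0 <= i < n.+1) f i * g (n - i)%N.

Lemma eq_conv f f' g g' n :
  (forall i, (i <= n)%N -> f i = f' i) -> (forall i, (i <= n)%N -> g i = g' i) ->
  conv f g n = conv f' g' n.
Proof.
move=> eqf eqg; apply: eq_big_nat => i /andP[_ lt_in].
by rewrite eqf ?eqg ?leq_subr.
Qed.

Lemma convC f g n : conv f g n = conv g f n.
Proof.
rewrite /conv big_nat_rev /=; apply: eq_big_nat => i /andP[_ lt_in].
by rewrite add0n subSS mulrC subKn.
Qed.

Lemma convDr f g h n : conv f (fun i => g i + h i) n = conv f g n + conv f h n.
Proof. by rewrite -big_split; apply: eq_bigr => i _; rewrite mulrDr. Qed.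

Lemma convBr f g h n : conv f (fun i => g i - h i) n = conv f g n - conv f h n.
Proof. by rewrite -sumrB; apply: eq_bigr => i _; rewrite mulrBr. Qed.

Lemma convZr a f g n : conv f (fun i => a * g i) n = a * conv f g n.
Proof. by rewrite /conv mulr_sumr; apply: eq_bigr => i _; rewrite mulrCA. Qed.

Lemma conv_delta f n : conv f (fun m => (m == 0%N)%:R) n = f n.
Proof.
rewrite /conv big_nat_recr //= subnn mulr1 big_nat big1 ?add0r // => i /andP[_ lt_in].
by rewrite subn_eq0 leqNgt lt_in mulr0.
Qed.

Lemma conv_shift f g n : conv f g n.+1 = f n.+1 * g 0%N + conv f (fun i => g i.+1) n.
Proof.
rewrite /conv big_nat_recr //= subnn addrC; congr (_ + _).
by apply: eq_big_nat => i /andP[_ lt_in]; rewrite subSn.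
Qed.

(** Both sides sum [f i * g j * h k] over the triples with [i + j + k = n]. *)
Lemma conv_left_comm f g h n : conv f (conv g h) n = conv g (conv f h) n.
Proof.
have expand a b : conv a (conv b h) n =
    \sum_(0 <= i < n.+1) \sum_(0 <= j < n.+1 | (i + j <= n)%N)
      a i * b j * h (n - (i + j))%N.
  apply: eq_big_nat => i /andP[_ lt_in]; rewrite /conv mulr_sumr.
  rewrite (big_nat_widen _ _ n.+1) ?ltnS ?leq_subr //.
  by apply: eq_big => j; [rewrite /= ltnS; lia | rewrite mulrA subnDA].
rewrite !expand (exchange_big_dep_nat xpredT) //=; apply: eq_bigr => i _.
apply: eq_big => j; first by rewrite addnC.
by rewrite addnC [f j * _]mulrC.
Qed.

End Convolution.

(** * Central binomial coefficients and Catalan numbers *)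

Definition central_bin (m : nat) : rat := 'C(m.*2, m)%:R.
Definition catalan (m : nat) : rat := central_bin m / m.+1%:R.

Lemma central_binS m :
  m.+1%:R * central_bin m.+1 = 2 * (2 * m%:R + 1) * central_bin m.
Proof.
have H : (m.+1 * 'C(m.+1.*2, m.+1) = 2 * (2 * m).+1 * 'C(m.*2, m))%N.
  rewrite doubleS binS.
  have e1 : ('C(m.*2.+1, m.+1) = 'C(m.*2.+1, m))%N.
    by rewrite -[LHS]bin_sub -?addnn ?ltnS ?leq_addr // -addSn subSS addnK.
  have e2 := mul_bin_left m.*2.+1 m.
  have e3 : (m.+1 * 'C(m.*2.+1, m) = m.*2.+1 * 'C(m.*2, m))%N.
    by rewrite -e1 -mul_bin_diag.
  rewrite e1; lia.
rewrite /central_bin; move: (congr1 (fun k => k%:R : rat) H).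
by rewrite !natrM -!natr1 !natrM => ->.
Qed.

Lemma central_bin0 : central_bin 0 = 1. Proof. by []. Qed.

Lemma catalanM m : m.+1%:R * catalan m = central_bin m.
Proof. by rewrite /catalan mulrCA divff ?mulr1 // pnatr_eq0. Qed.

(** This turns every convolution with Catalan numbers into convolutions with
    central binomial coefficients and their shift. *)
Lemma catalan_central_bin m :
  catalan m = 2 * central_bin m - central_bin m.+1 / 2.
Proof.
have nz : m.+1%:R != 0 :> rat by rewrite pnatr_eq0.
apply: (mulfI nz); rewrite catalanM mulrBr [_ * (_ / 2)]mulrA central_binS -natr1.
by field.
Qed.

(** The first-order recurrence [central_binS] says that the generating function
    satisfies [(1 - 4x) B' = 2 B], hence [(1 - 4x) (B^2)' = 4 B^2].  The proof is
    the coefficient form of this: by symmetry the weight [k] inside the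
    convolution can be replaced by half of the total degree. *)
Lemma conv_central_bin n : conv central_bin central_bin n = 4 ^+ n.
Proof.
have weight m : 2 * conv central_bin (fun k => k%:R * central_bin k) m =
    m%:R * conv central_bin central_bin m.
  rewrite mulr_natl mulr2n {1}convC -big_split /conv mulr_sumr.
  apply: eq_big_nat => i /andP[_ lt_im].
  have -> : m%:R = i%:R + (m - i)%:R :> rat by rewrite -natrD subnKC.
  by rewrite /=; ring.
elim: n => [|n IHn]; first by rewrite /conv big_nat1.
have nz : n.+1%:R != 0 :> rat by rewrite pnatr_eq0.
apply: (mulfI nz); rewrite -weight conv_shift mul0r mulr0 add0r.
under [conv _ _ n]eq_bigr => i _ do rewrite central_binS.
have -> : \sum_(0 <= i < n.+1) central_bin i *
    (2 * (2 * (n - i)%:R + 1) * central_bin (n - i)) =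
   conv central_bin
     (fun k => 4 * (k%:R * central_bin k) + 2 * central_bin k) n.
  by apply: eq_bigr => i _; ring.
rewrite convDr !convZr mulrDr.
have -> : 2 * (4 * conv central_bin (fun k => k%:R * central_bin k) n) =
  4 * (2 * conv central_bin (fun k => k%:R * central_bin k) n) by ring.
rewrite weight IHn exprS -natr1; ring.
Qed.

Lemma conv_catalan_central_bin n :
  conv catalan central_bin n = central_bin n.+1 / 2.
Proof.
rewrite convC (eq_conv (f' := central_bin)
  (g' := fun m => 2 * central_bin m - 2^-1 * central_bin m.+1)) //; last first.
  by move=> i _; rewrite catalan_central_bin [_ / 2]mulrC.
rewrite convBr !convZr conv_central_bin.
move: (conv_central_bin n.+1); rewrite conv_shift central_bin0 exprS => E.
lra.
Qed.

Lemma conv_catalan n : conv catalan catalan n = catalan n.+1.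
Proof.
rewrite (eq_conv (f' := catalan)
  (g' := fun m => 2 * central_bin m - 2^-1 * central_bin m.+1)) //; last first.
  by move=> i _; rewrite catalan_central_bin [_ / 2]mulrC.
rewrite convBr !convZr conv_catalan_central_bin.
move: (conv_catalan_central_bin n.+1) (catalan_central_bin n.+1).
rewrite conv_shift central_bin0 => E F.
lra.
Qed.

(** * Solving the recurrence *)

(** In terms of the generating functions [C] of the Catalan numbers and [B] of
    the central binomial coefficients, this is [(1 + B) / 2], which equals
    [(1 - x C) / (1 - 2 x C)]. *)
Definition half_bin (m : nat) : rat := (central_bin m + (m == 0%N)%:R) / 2.

Lemma half_binS m : half_bin m.+1 = 2 * conv catalan half_bin m - catalan m.
Proof.
have -> : conv catalan half_bin m =
  conv catalan (fun i => 2^-1 * central_bin i + 2^-1 * (i == 0%N)%:R) m.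
  by apply: eq_conv => // i _; rewrite /half_bin mulrC mulrDr.
rewrite convDr !convZr conv_catalan_central_bin conv_delta /half_bin /=.
by field.
Qed.

(** After substituting the solution for [g] on the right and moving [catalan]
    inside, both sides are convolutions of [phi * catalan], compared coefficient
    by coefficient by [half_binS]. *)
Lemma catalan_recurrence_solution (phi g : nat -> rat) :
  g 0%N = phi 0%N ->
  (forall n, g n.+1 = 2 * conv catalan g n + phi n.+1 * catalan n.+1
               - conv (fun k => phi k * catalan k) catalan n) ->
  forall n, g n = conv (fun k => phi k * catalan k) half_bin n.
Proof.
move=> g0 gS; elim/ltn_ind=> -[_|n IHn].
  by rewrite g0 /conv big_nat1 /= /half_bin /catalan central_bin0 /=; field.
rewrite gS (eq_conv (f' := catalan) (g' := conv (fun k => phi k * catalan k) half_bin)) //.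
rewrite conv_left_comm conv_shift -[2 * _]convZr addrAC -convBr addrC.
congr (_ + _); first by rewrite /half_bin central_bin0 /=; field.
by apply: eq_conv => // i _; rewrite half_binS.
Qed.

(** * Decomposition of Catalan words *)

Local Open Scope nat_scope.

Definition catalan_words (n : nat) : seq (seq nat) :=
  [seq map val w | w : n.-tuple 'I_n.+1 <- enum {: n.-tuple 'I_n.+1} & catalan_word (map val w)].

Lemma mem_catalan_words n w :
  (w \in catalan_words n) = catalan_word w && (size w == n).
Proof.
apply/mapP/andP => [[t]|[cw /eqP <-]].
  by rewrite mem_filter => /andP[ct _] ->; rewrite size_map size_tuple.
have [t tE] := catalan_word_tuple cw.
by exists t => //; rewrite mem_filter mem_enum tE cw.
Qed.

Lemma catalan_words_uniq n : uniq (catalan_words n).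
Proof.
rewrite map_inj_uniq; first by rewrite filter_uniq // enum_uniq.
by move=> t1 t2 /(inj_map val_inj)/val_inj.
Qed.

Definition glue (u v : seq nat) : seq nat := 1 :: map S u ++ v.

Lemma size_glue u v : size (glue u v) = (size u + size v).+1.
Proof. by rewrite /= size_cat size_map. Qed.

Lemma catalan_word_glue u v :
  catalan_word u -> catalan_word v -> catalan_word (glue u v).
Proof.
move=> /and3P[pu hu su] /and3P[pv hv sv]; rewrite /catalan_word /=.
rewrite all_cat pv all_map (sub_all _ pu) //= cat_path.
have -> : path (fun x y => y <= x.+1) 1 (map S u).
  case: u {pu} hu su => //= x u /eqP-> su.
  by rewrite path_map.
case: v hv sv {pv} => //= y v /eqP-> ->.
by rewrite andbT.
Qed.

(** The cut point of [glue u v] can be recovered from the word: [u] raised by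
    one contains no letter 1, and [v], unless empty, starts with one. *)
Lemma find_one_glue u v : all (ltn 0) u -> head 1 v == 1 ->
  find (pred1 1) (map S u ++ v) = size u.
Proof.
move=> pu hv; rewrite find_cat ifN; last first.
  by rewrite has_map; apply/hasPn => x /(allP pu) /=; case: x.
by case: v hv => [|y v] /=; rewrite size_map ?addn0 // => ->; rewrite addn0.
Qed.

Lemma glue_inj u v u' v' : catalan_word u -> catalan_word v ->
  catalan_word u' -> catalan_word v' -> glue u v = glue u' v' ->
  u = u' /\ v = v'.
Proof.
move=> /and3P[pu _ _] /and3P[_ hv _] /and3P[pu' _ _] /and3P[_ hv' _] [E].
have sz : size u = size u'.
  by rewrite -(find_one_glue pu hv) E (find_one_glue pu' hv').
by move/eqP: E; rewrite eqseq_cat ?size_map // => /andP[/eqP/(inj_map succn_inj)-> /eqP->].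
Qed.

(** The word is cut before its second letter 1.  The letters in between are at
    least 2 and the first of them is at most 2, so lowering them by one gives a
    Catalan word. *)
Lemma catalan_word_unglue x w : catalan_word (x :: w) ->
  exists u v, [/\ catalan_word u, catalan_word v & x :: w = glue u v].
Proof.
move=> /and3P[/= /andP[_ pw] /eqP-> sw].
pose k := find (pred1 1) w.
have t2 : all (ltn 1) (take k w).
  apply/(all_nthP 0) => i; rewrite size_take_min leq_min => /andP[ik iw].
  rewrite nth_take //= ltn_neqAle (allP pw) ?mem_nth // andbT eq_sym.
  by have /= -> := before_find 0 ik.
have tE : map S (map predn (take k w)) = take k w.
  by rewrite -map_comp -[RHS]map_id; apply/eq_in_map => y /(allP t2) /ltnW /prednK.
exists (map predn (take k w)), (drop k w); split.
- move: sw; rewrite -{1}(cat_take_drop k w) cat_path => /andP[st _].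
  rewrite /catalan_word; apply/and3P; split.
  + by rewrite all_map; apply: sub_all t2 => -[|[|y]].
  + by case: (take k w) t2 st => [|[|[|y]] r] //= _ /andP[y2]; case: y y2.
  + move: st; rewrite -{1}tE; case: (map predn (take k w)) => //= y r /andP[_].
    by rewrite path_map.
- apply/and3P; split.
  + by apply/allP => y /mem_drop /(allP pw).
  + case E: (drop k w) => [//|y r] /=.
    have kw : k < size w by rewrite ltnNge; apply/negP => /drop_oversize; rewrite E.
    have := nth_find 0 (_ : has (pred1 1) w); rewrite -/k.
    rewrite -[k in nth _ _ k]addn0 -nth_drop E /= => -> //.
    by rewrite has_find.
  + move: sw; rewrite -{1}(cat_take_drop k w) cat_path => /andP[_].
    by case: (drop k w) => //= y r /andP[].
- by rewrite /glue tE cat_take_drop.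
Qed.

Lemma big_catalan_wordsS (F : seq nat -> nat) n :
  \sum_(w <- catalan_words n.+1) F w =
  \sum_(0 <= i < n.+1) \sum_(u <- catalan_words i)
    \sum_(v <- catalan_words (n - i)) F (glue u v).
Proof.
pose pairs i := [seq (u, v) | u <- catalan_words i, v <- catalan_words (n - i)].
have pairsP i u v : (u, v) \in pairs i -> [/\ catalan_word u, catalan_word v & size u = i].
  case/allpairsP => -[u' v'] [/=]; rewrite !mem_catalan_words.
  by move=> /andP[cu /eqP<-] /andP[cv _] [-> ->].
transitivity (\sum_(w <- [seq glue p.1 p.2 | i <- iota 0 n.+1, p <- pairs i]) F w).
  apply/perm_big/uniq_perm; first exact: catalan_words_uniq.
    apply: allpairs_uniq_dep; first exact: iota_uniq.
      move=> i _; apply: allpairs_uniq; rewrite ?catalan_words_uniq //.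
      by move=> [? ?] [? ?] _ _ [-> ->].
    move=> _ _ /allpairsPdep[i [[u v] [_ pi ->]]] /allpairsPdep[j [[u' v'] [_ pj ->]]] /=.
    have [cu cv su] := pairsP _ _ _ pi; have [cu' cv' su'] := pairsP _ _ _ pj.
    case/glue_inj => // uu' vv'.
    by subst u' v' i j.
  move=> w; apply/idP/allpairsPdep => [|[i [[u v] [ii /allpairsP[[u' v'] /= [mu mv [-> ->]]] ->]]]].
    rewrite mem_catalan_words; case: w => [//|x w] /andP[].
    case/catalan_word_unglue=> u [v [cu cv ->]]; rewrite size_glue eqSS => /eqP E.
    exists (size u), (u, v); split=> //.
      by rewrite mem_iota /= add0n ltnS -E leq_addr.
    apply/allpairsP; exists (u, v).
    by rewrite !mem_catalan_words cu cv !eqxx -E addKn eqxx.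
  move: mu mv ii; rewrite !mem_catalan_words mem_iota => /andP[cu /eqP su] /andP[cv /eqP sv].
  by rewrite catalan_word_glue //= add0n ltnS size_cat size_map su sv eqSS => /subnKC->.
rewrite big_allpairs_dep /index_iota subn0; apply: eq_bigr => i _.
by rewrite big_allpairs_dep.
Qed.

(** * Occurrences in a glued word *)

(** The smallest of the first [s.+1] letters.  A word with fewer letters gets 0,
    through the default value of [head], so that windows passing the right end
    contribute nothing. *)
Fixpoint window_min (s : nat) (w : seq nat) : nat :=
  if s is s'.+1 then minn (head 0 w) (window_min s' (behead w)) else head 0 w.

(** The number of occurrences of the rectangle of width [s.+1], by the column
    of the left end ([window_sumE]). *)
Fixpoint window_sum (s : nat) (w : seq nat) : nat :=
  if w is _ :: w' then window_min s w + window_sum s w' else 0.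

Lemma window_min_short s w : size w <= s -> window_min s w = 0.
Proof.
elim: s w => [|s IHs] [|x w] //=; first by rewrite min0n.
by rewrite ltnS => /IHs ->; rewrite minn0.
Qed.

Lemma window_min_gt0 s w : all (ltn 0) w -> (0 < window_min s w) = (s < size w).
Proof.
elim: s w => [|s IHs] [|x w] //=; first by case/andP.
  by rewrite min0n.
by case/andP => x0 /IHs; rewrite leq_min x0 ltnS.
Qed.

Lemma window_min_one s w : all (ltn 0) w -> head 1 w == 1 ->
  window_min s w = (s < size w).
Proof.
move=> pw hw; have := window_min_gt0 s pw.
case: w hw {pw} => [|x w] /=; first by rewrite window_min_short.
move=> /eqP->; suff : window_min s (1 :: w) <= 1.
  by case: (window_min s (1 :: w)) => [|[|m]] // _ <-.
by case: s => //= s; apply: geq_minl.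
Qed.

(** A window within [u] gains one by the raising, and a window that meets [v]
    contains its first letter 1. *)
Lemma window_min_cat s u v : all (ltn 0) v -> head 1 v == 1 ->
  window_min s (map S u ++ v) = window_min s u + (s < size u + size v).
Proof.
move=> pv hv; elim: s u => [|s IHs] [|x u] /=.
- exact: (window_min_one 0).
- by rewrite addn1.
- by rewrite min0n; exact: (window_min_one s.+1).
- rewrite IHs addSn ltnS; case: ltnP => H; first by rewrite !addn1 minnSS.
  by rewrite window_min_short ?minn0 // (leq_trans (leq_addr _ _) H).
Qed.

Lemma window_sum_cat s u v : all (ltn 0) v -> head 1 v == 1 ->
  window_sum s (map S u ++ v) + (size v - s) =
  window_sum s u + window_sum s v + (size u + size v - s).
Proof.
move=> pv hv; elim: u => [|x u IHu] //=.
have /= -> := window_min_cat s (x :: u) pv hv.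
move: IHu; lia.
Qed.

(** The truncated difference [size v - s] counts the placements in the bottom
    row of [v], which are the only ones of [v] that are not above the bottom row
    of the glued word. *)
Lemma window_sum_glue s u v : catalan_word v ->
  window_sum s (glue u v) + (size v - s) =
  window_sum s u + window_sum s v + ((size u + size v).+1 - s).
Proof.
case/and3P => pv hv _; rewrite /glue.
have := window_sum_cat s u pv hv.
have gt0 : all (ltn 0) (1 :: map S u ++ v).
  by rewrite /= all_cat pv andbT all_map; apply/allP.
rewrite [window_sum s (1 :: _)]/= window_min_one //= size_cat size_map; lia.
Qed.

(** The two sides index the same windows: those that pass the right end
    contribute 0 on the left and are excluded from the range on the right. *)
Lemma window_sumE s w :
  window_sum s w = \sum_(i < (size w).+1 - s.+1)
    foldr minn (nth 0 w i) (take s.+1 (drop i w)).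
Proof.
have windowE x l : s <= size l -> forall m,
    foldr minn m (take s.+1 (x :: l)) = minn m (window_min s (x :: l)).
  elim: s x l => [|k IHk] x l; first by move=> _ m /=; rewrite take0 /= minnC.
  by case: l => //= y l /(IHk y) /= E m; rewrite E minnCA.
have windowE' x l : s <= size l ->
    foldr minn x (take s.+1 (x :: l)) = window_min s (x :: l).
  move=> /windowE->; apply/minn_idPr; case: (s) => //= k; exact: geq_minl.
rewrite subSS; elim: w => [|x w IHw]; first by rewrite big_ord0.
rewrite [window_sum _ _]/= [size (_ :: _)]/=; have [sw|ws] := leqP s (size w).
  by rewrite subSn // big_ord_recl drop0 windowE' // IHw.
have E : (size w).+1 - s = 0 by apply/eqP; rewrite subn_eq0.
rewrite E big_ord0 IHw window_min_short // add0n.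
by rewrite (eqP (ltnW ws)) big_ord0.
Qed.

(** * Totals over all Catalan words *)

Lemma total_rect_occE s n :
  total_rect_occ s.+1 n = \sum_(w <- catalan_words n) window_sum s w.
Proof.
rewrite /total_rect_occ big_map big_filter big_enum_cond /=.
by apply: eq_bigr => w _; rewrite rect_occE // window_sumE.
Qed.

Lemma catalan_words0 : catalan_words 0 = [:: [::]].
Proof.
apply: perm_small_eq => //; apply: uniq_perm; rewrite ?catalan_words_uniq // => w.
by rewrite mem_catalan_words inE; case: w => [//|x w]; rewrite andbF.
Qed.

Local Open Scope ring_scope.

Lemma size_catalan_words n : (size (catalan_words n))%:R = catalan n.
Proof.
elim/ltn_ind: n => -[_|n IHn]; first by rewrite catalan_words0.
rewrite -conv_catalan -sum1_size big_catalan_wordsS natr_sum.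
apply: eq_big_nat => i /andP[_ lt_in].
rewrite -!IHn ?ltnS ?leq_subr // -natrM; congr _%:R.
under eq_bigr do rewrite sum1_size.
by rewrite big_const_seq count_predT iter_addn_0 mulnC.
Qed.

Lemma sum_separable (A B : Type) (r : seq A) (t : seq B)
    (a : A -> rat) (b : B -> rat) (c : rat) :
  \sum_(x <- r) \sum_(y <- t) (a x + b y + c) =
  (\sum_(x <- r) a x) * (size t)%:R + (size r)%:R * (\sum_(y <- t) b y)
    + (size r)%:R * (size t)%:R * c.
Proof.
have const (I : Type) (l : seq I) (d : rat) : \sum_(x <- l) d = (size l)%:R * d.
  by rewrite big_const_seq count_predT iter_addr_0 mulr_natl.
under eq_bigr do rewrite 2!big_split /= !const.
by rewrite 2!big_split /= !const -mulr_sumr [(size t)%:R * _]mulrC mulrA.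
Qed.

Lemma total_rect_occS s n (phi := fun k => (k - s)%N%:R : rat) :
  (total_rect_occ s.+1 n.+1)%:R =
    2 * conv catalan (fun m => (total_rect_occ s.+1 m)%:R) n
    + phi n.+1 * catalan n.+1 - conv (fun k => phi k * catalan k) catalan n.
Proof.
rewrite total_rect_occE big_catalan_wordsS natr_sum.
pose W w : rat := (window_sum s w)%:R.
pose t m : rat := (total_rect_occ s.+1 m)%:R.
have tE m : \sum_(w <- catalan_words m) W w = t m.
  by rewrite /t total_rect_occE natr_sum.
transitivity (\sum_(0 <= i < n.+1) (t i * catalan (n - i) + catalan i * t (n - i)%N
   + catalan i * catalan (n - i) * (phi n.+1 - phi (n - i)%N))).
  apply: eq_big_nat => i /andP[_ lt_in].
  rewrite -!tE -!size_catalan_words -sum_separable natr_sum.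
  apply: eq_big_seq => u; rewrite mem_catalan_words => /andP[_ /eqP su].
  rewrite natr_sum; apply: eq_big_seq => v.
  rewrite mem_catalan_words => /andP[cv /eqP sv].
  move: (congr1 (fun k => k%:R : rat) (window_sum_glue s u cv)).
  rewrite su sv subnKC // !natrD -/(W _) -/(W u) -/(W v) -/(phi _) -/(phi _) => E.
  by rewrite -[LHS](addrK (phi (n - i)%N)) E addrA.
have -> : phi n.+1 * catalan n.+1 = conv catalan (fun m => phi n.+1 * catalan m) n.
  by rewrite convZr conv_catalan.
rewrite (convC (fun k => phi k * catalan k)) mulr_natl mulr2n {1}convC.
rewrite -/t -!big_split -sumrB.
by apply: eq_bigr => i _ /=; ring.
Qed.

Lemma total_rect_occ_conv s n :
  (total_rect_occ s.+1 n)%:R =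
    conv (fun k => (k - s)%N%:R * catalan k) half_bin n.
Proof.
apply: (catalan_recurrence_solution (g := fun n => (total_rect_occ s.+1 n)%:R)).
  by rewrite total_rect_occE catalan_words0 big_seq1.
exact: total_rect_occS.
Qed.

Unset Implicit Arguments.

Theorem theorem9 (s n : nat) (hs : (1 <= s)%N) (hn : (s - 1 <= n)%N) :
  (total_rect_occ s n)%:R =
    1 / 2 *
    (\sum_(0 <= i < s - 1)
        (s%:R - 1 - i%:R) / (i%:R + 1)
          * ('C(2 * i, i))%:R * ('C(2 * n - 2 * i, n - i))%:R
      - (2 * s%:R - 1) * ('C(2 * n, n))%:R + 4 ^+ n) :> rat.
Proof.
case: s hs hn => // s _; rewrite subSS subn0 => le_sn.
rewrite total_rect_occ_conv.
pose c k : rat := catalan k * central_bin (n - k).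
have -> : \sum_(0 <= i < s) (s.+1%:R - 1 - i%:R) / (i%:R + 1)
          * ('C(2 * i, i))%:R * ('C(2 * n - 2 * i, n - i))%:R
   = \sum_(0 <= i < s) (s%:R - i%:R) * c i.
  apply: eq_bigr => i _.
  rewrite /c /catalan /central_bin -mulnBr !mul2n -!natr1; ring.
rewrite mul2n -/(central_bin n).
(* Untruncating changes only the terms below s, where k - s is 0 on nat. *)
have truncE : conv (fun k => (k - s)%N%:R * catalan k) central_bin n =
    \sum_(0 <= k < n.+1) (k%:R - s%:R) * c k + \sum_(0 <= k < s) (s%:R - k%:R) * c k.
  rewrite /conv (big_cat_nat (n := s)) ?leqW //= [in RHS](big_cat_nat (n := s)) ?leqW //=.
  rewrite addrAC -big_split /=; congr (_ + _).
    apply: eq_big_nat => k /andP[_ /ltnW]; rewrite -subn_eq0 => /eqP->; ring.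
  by apply: eq_big_nat => k /andP[le_sk _]; rewrite natrB // -mulrA.
have fullE : \sum_(0 <= k < n.+1) (k%:R - s%:R) * c k =
    4 ^+ n - s.+1%:R * (2 * central_bin n - catalan n).
  have -> : 2 * central_bin n - catalan n = conv catalan central_bin n.
    by rewrite conv_catalan_central_bin catalan_central_bin; ring.
  rewrite -conv_central_bin -convZr -sumrB; apply: eq_bigr => k _.
  rewrite /c -(catalanM k) -!natr1; ring.
(* half_bin differs from half of central_bin only at 0, that is at k = n. *)
have -> : conv (fun k => (k - s)%N%:R * catalan k) half_bin n =
   2^-1 * (conv (fun k => (k - s)%N%:R * catalan k) central_bin n
     + (n%:R - s%:R) * catalan n).
  rewrite -natrB // -[_ * catalan n](conv_delta (fun k => (k - s)%N%:R * catalan k)).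
  by rewrite -convDr -convZr; apply: eq_conv => // i _; rewrite /half_bin mulrC.
rewrite truncE fullE.
move: (catalanM n); rewrite -!natr1 => <-; ring.
Qed.
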